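(* Let $d\ge1$, $E_1=[-1,1]^d$, and let $v_+^i,v_-^i:E_1\to[0,\infty)$, $1\le i\le d$, be continuous functions such that for every $i$ the following holds. The function $v_+^i$ is identically zero, or both of the following conditions hold: (a) $v_+^i(x)>0$ if $x_i\neq 1$; (b) for every $z\in[-1,1]^d$ with $z_i=1$ we have $v_+^i(z)=0$, and there exists a neighbourhood $U_z$ of $z$ on which there is a decomposition $v_+^i(x)=v_{+,z,\dagger}^i(x_i)\,v_{+,z,\ddagger}^i(x)$, where $v_{+,z,\dagger}^i$ is decreasing and where $v_{+,z,\ddagger}^i$ is continuous and satisfies $v_{+,z,\ddagger}^i(z)\neq 0$. The function $v_-^i$ is identically zero, or both of the following conditions hold: (a) $v_-^i(x)>0$ if $x_i\neq -1$; (b) for every $z\in[-1,1]^d$ with $z_i=-1$ we have $v_-^i(z)=0$, and there exists a neighbourhood $U_z$ of $z$ on which there is a decomposition $v_-^i(x)=v_{-,z,\dagger}^i(x_i)\,v_{-,z,\ddagger}^i(x)$, where $v_{-,z,\dagger}^i$ is increasing and where $v_{-,z,\ddagger}^i$ is continuous and satisfies $v_{-,z,\ddagger}^i(z)\neq 0$. Let $H:E_1\times\mathbb{R}^d\to\mathbb{R}$ be given by $$H(x,p)=\sum_{i=1}^d \left( v_+^i(x)\left[e^{2p_i}-1\right]+v_-^i(x)\left[e^{-2p_i}-1\right]\right).$$ Then, for every $\lambda>0$ and $h\in C(E_1)$, the comparison principle holds for the equation $f(x)-\lambda H(x,\nabla f(x))-h(x)=0$ on $E_1$.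
   Context: For a compact set $E\subseteq\mathbb{R}^d$, $C(E)$ denotes the continuous real functions on $E$ and $C^1(E)$ the functions that are continuously differentiable on a neighbourhood of $E$ in $\mathbb{R}^d$. For a continuous $H:E\times\mathbb{R}^d\to\mathbb{R}$, $\lambda>0$ and $h\in C(E)$ consider the equation $$f(x)-\lambda H(x,\nabla f(x))-h(x)=0,\qquad x\in E. \quad ( * )$$ A function $u:E\to\mathbb{R}$ is a (viscosity) subsolution of $( * )$ if $u$ is bounded and upper semi-continuous and, for every $f\in C^1(E)$ and $x\in E$ such that $u-f$ has a maximum (over $E$) at $x$, one has $u(x)-\lambda H(x,\nabla f(x))-h(x)\le0$. A function $v:E\to\mathbb{R}$ is a (viscosity) supersolution of $( * )$ if $v$ is bounded and lower semi-continuous and, for every $f\in C^1(E)$ and $x\in E$ such that $v-f$ has a minimum (over $E$) at $x$, one has $v(x)-\lambda H(x,\nabla f(x))-h(x)\ge0$. Equation $( * )$ satisfies the comparison principle if $u\le v$ on $E$ for every subsolution $u$ and every supersolution $v$. *)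

(* Defs.v *)
From HB Require Import structures.
From mathcomp Require Import all_boot all_order all_algebra.
From mathcomp Require Import all_classical all_reals all_analysis.

Set Implicit Arguments.
Unset Strict Implicit.
Unset Printing Implicit Defensive.

Import Order.TTheory GRing.Theory Num.Theory.
Import numFieldNormedType.Exports.

Local Open Scope classical_set_scope.
Local Open Scope ring_scope.

(* Points of R^d are row vectors 'rV[R]_d.  A function on a set E is the
   restriction to E of a total function: the definitions below only ever
   constrain its values on E. *)

Definition grad (R : realType) (d : nat) (f : 'rV[R]_d -> R) (x : 'rV[R]_d) :
  'rV[R]_d := \row_(i < d) 'D_(delta_mx 0 i) f x.

Definition C1_on (R : realType) (d : nat) (E : set 'rV[R]_d)
    (f : 'rV[R]_d -> R) : Prop :=
  exists U : set 'rV[R]_d,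
    [/\ open U, E `<=` U,
        forall x, U x -> differentiable f x &
        forall x, U x -> {for x, continuous (grad f)}].

(* In [subspace E] the points of E carry their relative neighbourhoods and the
   points outside E are isolated, so nothing is required outside E. *)
Definition lsc_on (R : realType) (d : nat) (E : set 'rV[R]_d)
    (v : 'rV[R]_d -> R) : Prop :=
  lower_semicontinuous (fun x : subspace E => (v x)%:E).

Definition usc_on (R : realType) (d : nat) (E : set 'rV[R]_d)
    (u : 'rV[R]_d -> R) : Prop :=
  lsc_on E (fun x => - u x).

Definition viscosity_subsolution (R : realType) (d : nat) (E : set 'rV[R]_d)
    (H : 'rV[R]_d -> 'rV[R]_d -> R) (lambda : R) (h u : 'rV[R]_d -> R) : Prop :=
  [/\ [bounded u x | x in E], usc_on E u &
      forall (f : 'rV[R]_d -> R) (x : 'rV[R]_d),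
        C1_on E f -> E x -> (forall y, E y -> u y - f y <= u x - f x) ->
        u x - lambda * H x (grad f x) - h x <= 0].

Definition viscosity_supersolution (R : realType) (d : nat) (E : set 'rV[R]_d)
    (H : 'rV[R]_d -> 'rV[R]_d -> R) (lambda : R) (h v : 'rV[R]_d -> R) : Prop :=
  [/\ [bounded v x | x in E], lsc_on E v &
      forall (f : 'rV[R]_d -> R) (x : 'rV[R]_d),
        C1_on E f -> E x -> (forall y, E y -> v x - f x <= v y - f y) ->
        0 <= v x - lambda * H x (grad f x) - h x].

Definition comparison_principle (R : realType) (d : nat) (E : set 'rV[R]_d)
    (H : 'rV[R]_d -> 'rV[R]_d -> R) (lambda : R) (h : 'rV[R]_d -> R) : Prop :=
  forall u v : 'rV[R]_d -> R,
    viscosity_subsolution E H lambda h u ->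
    viscosity_supersolution E H lambda h v ->
    forall x, E x -> u x <= v x.

Definition cube (R : realType) (d : nat) : set 'rV[R]_d :=
  [set x | forall i, -1 <= x ord0 i <= 1].
Arguments cube : clear implicits.

(* The set on which the one-variable factor has to be monotone is the i-th
   projection of the relative neighbourhood of z; monotone is meant in the
   non-strict sense. *)
Definition plus_rate (R : realType) (d : nat) (i : 'I_d)
    (v : 'rV[R]_d -> R) : Prop :=
  (forall x, cube R d x -> v x = 0) \/
  (forall x, cube R d x -> x ord0 i != 1 -> 0 < v x) /\
  (forall z, cube R d z -> z ord0 i = 1 ->
     v z = 0 /\
     exists (U : set 'rV[R]_d) (v1 : R -> R) (v2 : 'rV[R]_d -> R),
       [/\ nbhs z U,
           forall x, (U `&` cube R d) x -> v x = v1 (x ord0 i) * v2 x,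
           {in [set x ord0 i | x in U `&` cube R d] &, nonincreasing_fun v1},
           {within U `&` cube R d, continuous v2} &
           v2 z != 0]).

Definition minus_rate (R : realType) (d : nat) (i : 'I_d)
    (v : 'rV[R]_d -> R) : Prop :=
  (forall x, cube R d x -> v x = 0) \/
  (forall x, cube R d x -> x ord0 i != -1 -> 0 < v x) /\
  (forall z, cube R d z -> z ord0 i = -1 ->
     v z = 0 /\
     exists (U : set 'rV[R]_d) (v1 : R -> R) (v2 : 'rV[R]_d -> R),
       [/\ nbhs z U,
           forall x, (U `&` cube R d) x -> v x = v1 (x ord0 i) * v2 x,
           {in [set x ord0 i | x in U `&` cube R d] &, nondecreasing_fun v1},
           {within U `&` cube R d, continuous v2} &
           v2 z != 0]).

Definition ehrenfest_hamiltonian (R : realType) (d : nat)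
    (vp vm : 'I_d -> 'rV[R]_d -> R) (x p : 'rV[R]_d) : R :=
  \sum_(i < d) (vp i x * (expR (2 * p ord0 i) - 1) +
                vm i x * (expR (- 2 * p ord0 i) - 1)).

(* Main.v *)
Require Import Defs.
From HB Require Import structures.
From mathcomp Require Import all_boot all_order all_algebra.
From mathcomp Require Import all_classical all_reals all_analysis.
From mathcomp Require Import ring lra.

Set Implicit Arguments.
Unset Strict Implicit.
Unset Printing Implicit Defensive.

Import Order.TTheory GRing.Theory Num.Theory.
Import numFieldNormedType.Exports.

Local Open Scope classical_set_scope.
Local Open Scope ring_scope.

(* Doubling of variables: let (x_n, y_n) maximise u x - v y - n |x - y|^2 over
   the square of the cube and put p = 2n (x_n - y_n).  It suffices to make
   H(x_n, p) - H(y_n, p) small near a common cluster point z of both sequences.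
   The supersolution inequality bounds H(y_n, p) from above; each of its terms
   w(y_n) (e^{+-2 p_i} - 1) is bounded below, hence each is bounded.  If w z > 0,
   this bounds the exponential and continuity of w is enough.  If w z = 0 and w
   is not identically zero, then z lies on the face where w vanishes; the
   exponential can only be large when x_n is closer to that face than y_n, and
   then monotonicity of the one-variable factor gives
   w(x_n) <= (1 + o(1)) w(y_n). *)

(** * Semicontinuity and compactness *)

(** Any two of the sets [B y] are nested, so they form a filter base. At a cluster point of it, a
    value below some [f y] would contradict upper semicontinuity. *)
Lemma usc_compact_max (R : realType) (T : topologicalType) (K : set T)
    (f : T -> R) :
  compact K -> K !=set0 ->
  (forall x, K x -> forall a, f x < a -> \forall y \near within K (nbhs x), f y < a) ->
  exists2 x, K x & forall y, K y -> f y <= f x.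
Proof.
move=> cK [k0 Kk0] uscf.
pose B y := K `&` [set x | f y <= f x].
have FF : ProperFilter (filter_from K B).
  apply: filter_from_proper; last by move=> y Ky; exists y; split => //=.
  apply: filter_from_filter; first by exists k0.
  move=> y1 y2 Ky1 Ky2; have [le12|/ltW le21] := leP (f y1) (f y2).
    by exists y2 => // x [Kx le2x]; split; split=> //=; exact: le_trans le2x.
  by exists y1 => // x [Kx le1x]; split; split=> //=; exact: le_trans le1x.
have FK : filter_from K B K by exists k0 => // x [].
have [x [Kx clx]] := cK _ FF FK.
exists x => // y Ky; rewrite leNgt; apply/negP => fxy.
have FB : filter_from K B (B y) by exists y.
have [t [[Kt fyt] /(_ Kt)]] := clx _ _ FB (uscf x Kx _ fxy).
by rewrite ltNge fyt.
Qed.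

(** Replaces the extraction of a convergent subsequence: one index [n] is enough, since every
    estimate needed later holds near [(z, z)]. *)
Lemma compact_cluster_pair (R : realType) (V : pseudoMetricType R)
    (K : set V) (xs ys : nat -> V) :
  compact K -> (forall n, K (xs n)) -> (forall n, K (ys n)) ->
  (forall e, 0 < e -> \forall n \near \oo, ball (xs n) e (ys n)) ->
  exists2 z, K z &
    forall P : V -> V -> Prop,
    (\forall x \near within K (nbhs z) & y \near within K (nbhs z), P x y) ->
    exists n, P (xs n) (ys n).
Proof.
move=> cK Kxs Kys xys.
have FK : (xs @ \oo) K by exists 0%N => // n _; exact: Kxs.
have [z [Kz clz]] := cK _ _ FK; exists z => // P [[A B] /= [zA zB] ABP].
have /nbhs_ballP[e /= e0 eB] := zB.
have zA' : nbhs z ([set x | K x -> A x] `&` ball z (e / 2)).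
  by apply: filterI => //; apply: nbhsx_ballx; rewrite divr_gt0.
(* Clustering speaks of sets of points, so the condition on [n] is carried by the image of the good
   indices; a point of that image near [z] gives back such an index. *)
have Fx : (xs @ \oo) [set xs n | n in [set n | ball (xs n) (e / 2) (ys n)]].
  have := xys _ (divr_gt0 e0 (ltr0Sn R 1)).
  by apply: filterS => n nball; exists n.
have [_ [[n /= nball <-] [An zn]]] := clz _ _ Fx zA'.
exists n; apply: (ABP (xs n, ys n)); split => /=; first exact: An.
by apply: eB => //; exact: ball_split zn nball.
Qed.

Lemma lsc_on_near (R : realType) (d : nat) (E : set 'rV[R]_d)
    (v : 'rV[R]_d -> R) (x : 'rV[R]_d) (a : R) :
  lsc_on E v -> E x -> a < v x -> \forall y \near within E (nbhs x), a < v y.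
Proof.
move=> lscv Ex avx; have [|W xW aW] := lscv x a; first by rewrite lte_fin.
have : within E (nbhs x) W by rewrite nbhs_subspace_in.
by apply: filterS => y /aW; rewrite lte_fin.
Qed.

(** * The squared distance as a test function *)

(** The norm of ['rV[R]_d] is the maximum norm, whose square is not smooth in general; the penalty
    uses the Euclidean one. *)
Definition sqdist (R : realType) (d : nat) (x y : 'rV[R]_d) : R :=
  \sum_(i < d) (x ord0 i - y ord0 i) ^+ 2.

Lemma is_derive_coord (R : realType) (d : nat) (x v : 'rV[R]_d) (j : 'I_d) :
  is_derive x v (fun t : 'rV[R]_d => t 0 j) (v 0 j).
Proof.
have dj := @differentiable_coord R 1 d x 0 j.
split; first exact: diff_derivable.
(* A continuous linear map is its own differential; [gL] gives the coordinate its linear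
   structure. *)
pose g (t : 'rV[R]_d) := t 0 j.
have gl : linear g by move=> a y z; rewrite /g !mxE.
pose gL : {linear 'rV[R]_d -> R^o} := HB.pack g (GRing.isLinear.Build _ _ _ _ _ gl).
rewrite deriveE // (_ : (fun t : 'rV[R]_d => t 0 j) = gL) // diff_lin //.
exact: coord_continuous.
Qed.

Lemma is_derive_sqdist (R : realType) (d : nat) (c : R) (y x v : 'rV[R]_d) :
  is_derive x v (fun t => c * sqdist t y)
    (2 * c * \sum_(i < d) (x 0 i - y 0 i) * v 0 i).
Proof.
have -> : (fun t => c * sqdist t y) =
    c \*: \sum_(i < d) (fun t : 'rV[R]_d => t 0 i - y 0 i) ^+ 2.
  by apply/funext => t; rewrite /sqdist /= fct_sumE.
have dc j : is_derive x v (fun t : 'rV[R]_d => t 0 j) (v 0 j).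
  exact: is_derive_coord.
apply: is_derive_eq.
rewrite [2 * c]mulrC -mulrA mulr_sumr; congr (_ * _); apply: eq_bigr => i _.
by rewrite expr1 subr0 /GRing.scale /= mulrA.
Qed.

(** Applied with [c = n] for the subsolution and with [c = - n] for the supersolution. *)
Lemma grad_sqdist (R : realType) (d : nat) (c : R) (y : 'rV[R]_d) :
  grad (fun t => c * sqdist t y) = fun x => (2 * c) *: (x - y).
Proof.
apply/funext => x; apply/rowP => i; rewrite !mxE.
have := is_derive_sqdist c y x (delta_mx 0 i) => /@derive_val ->.
rewrite (bigD1 i) //= big1 ?mxE ?eqxx ?addr0 ?mulr1 // => j ji.
by rewrite mxE (negPf ji) andbF mulr0.
Qed.

Lemma C1_sqdist (R : realType) (d : nat) (E : set 'rV[R]_d) (c : R) (y : 'rV[R]_d) :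
  C1_on E (fun t => c * sqdist t y).
Proof.
exists setT; split=> //; first exact: openT.
  move=> x _.
  have -> : (fun t => c * sqdist t y) =
     c *: \sum_(i < d) (fun t : 'rV[R]_d => t 0 i - y 0 i) ^+ 2.
    by apply/funext => t; rewrite /sqdist /= fct_sumE.
  apply/differentiableZ/differentiable_sum => i.
  apply: (@differentiableX _ _ _ 1).
  apply: (@differentiableB _ _ _ _ (cst (y 0 i))).
    exact: differentiable_coord.
  exact: differentiable_cst.
move=> x _; rewrite grad_sqdist.
have H : {for x, continuous (fun t : 'rV[R]_d => t - y)}.
  apply: continuousB; first exact: cvg_id. exact: cst_continuous.
have := continuousZ (@cst_continuous _ _ (2 * c) x) H.
exact.
Qed.

(** * Increments of the rates near a limit point *)

(** Once [w y > w0 / 2], the bound on [w y * q] bounds [q] itself, and [w x - w y] is as small as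
    desired. *)
Lemma near_increment_pos (R : realType) (T : Type) (F : set_system T)
    (FF : Filter F) (w : T -> R) (w0 C e : R) :
  0 < w0 -> w @ F --> w0 -> 0 < e ->
  \forall x \near F & y \near F, forall q,
    -1 <= q -> w y * q <= C -> (w x - w y) * q <= e.
Proof.
move=> w0_gt0 ww0 e_gt0.
(* [K] dominates both 1, for negative [q], and [2 * |C| / w0], for positive [q]. *)
pose K := 1 + 2 * `|C| / w0.
have K_gt0 : 0 < K.
  by apply: ltr_pwDl; rewrite ?divr_ge0 ?mulr_ge0 // ltW.
have K_ge : 2 * `|C| / w0 <= K by rewrite lerDr ler01.
have d_gt0 : 0 < e / K / 2 by rewrite !divr_gt0.
have near1 : F [set x | `|w0 - w x| < e / K / 2].
  by move: ww0 => /cvgrPdist_lt; exact.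
have near2 : F [set x | w0 / 2 < w x].
  by apply: (cvgr_gt w0) => //; lra.
exists ([set x | `|w0 - w x| < e / K / 2],
        [set x | `|w0 - w x| < e / K / 2] `&` [set x | w0 / 2 < w x]).
  by split => //; exact: filterI.
move=> [x y] /= [xd [yd y2]] q q_ge wqC.
have wxy : `|w x - w y| <= e / K.
  have -> : w x - w y = (w0 - w y) - (w0 - w x) by ring.
  by apply: (le_trans (ler_normB _ _)); rewrite [e / K]splitr lerD // ltW.
have qK : `|q| <= K.
  rewrite ler_norml; apply/andP; split.
    by apply: le_trans q_ge; rewrite lerN2 lerDl divr_ge0 ?mulr_ge0 // ltW.
  have [q_le0|q_gt0] := leP q 0; first exact: le_trans (ltW K_gt0).
  apply: le_trans K_ge; rewrite ler_pdivlMr //.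
  have CC : C <= `|C| by exact: ler_norm.
  nra.
apply: (le_trans (ler_norm _)); rewrite normrM.
apply: (le_trans (ler_pM _ _ wxy qK)) => //.
by rewrite divfK // gt_eqF.
Qed.

(* The one-variable factor [g1] only has to be monotone, not continuous: it is
   the multiplicative form that turns a bound on [w y * q] into a bound on the
   increment, as [w x / w y <= g2 x / g2 y] tends to 1. *)
Lemma near_increment_factor (R : realType) (T : Type) (F : set_system T)
    (FF : Filter F) (w g1 g2 : T -> R) (c C e : R) (A : T -> T -> Prop) :
  c != 0 -> g2 @ F --> c -> w @ F --> (0 : R) ->
  (\forall x \near F, w x = g1 x * g2 x) ->
  (\forall x \near F & y \near F,
     A x y -> [/\ 0 <= g1 y, g1 x <= g1 y & 0 <= g2 y]) ->
  0 < e ->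
  \forall x \near F & y \near F, forall q,
    -1 <= q -> (0 < q -> A x y) -> w y * q <= C -> (w x - w y) * q <= e.
Proof.
move=> c_neq0 g2c ww0 weq [[A1 A2] /= [FA1 FA2] HA] e_gt0.
(* Relative error allowed in [w x <= (1 + k) * w y], chosen so that [k * C <= e]. *)
pose k := e / (`|C| + 1).
have C1_gt0 : 0 < `|C| + 1 by rewrite ltr_wpDl.
have k_gt0 : 0 < k by rewrite divr_gt0.
have e2_gt0 : 0 < e / 2 by rewrite divr_gt0.
have near1 : F [set x | `|w x| < e / 2].
  by have /cvgr0Pnorm_lt := ww0; exact.
have c_gt0 : 0 < `|c| by rewrite normr_gt0.
(* Solves [2 * r = k * (c - r)] for positive [c]: then [g2 x - g2 y <= 2 * r <= k * g2 y]. *)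
pose r := `|c| * k / (2 + k).
have r_gt0 : 0 < r by rewrite divr_gt0 ?mulr_gt0 // addr_gt0.
have r_lt : r < `|c|.
  by rewrite ltr_pdivrMr ?addr_gt0 //; nra.
have near2 : F [set x | `|c - g2 x| < r].
  by move: g2c => /cvgrPdist_lt; exact.
pose B := [set x | `|w x| < e / 2] `&` [set x | `|c - g2 x| < r] `&`
  [set x | w x = g1 x * g2 x].
have FB : F B by apply: filterI => //; exact: filterI.
exists (A1 `&` B, A2 `&` B); first by split; exact: filterI.
move=> [x y] [/= [A1x [[xe xr] xw]] [A2y [[ye yr] yw]]] q q_ge qA wqC.
have wxy : `|w x - w y| <= e.
  by apply: (le_trans (ler_normB _ _)); rewrite [e]splitr lerD // ltW.
have [q_le0|q_gt0] := leP q 0.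
  apply: (le_trans (ler_norm _)); rewrite normrM -[leRHS]mulr1.
  by apply: ler_pM => //; rewrite ler0_norm // lerNl.
have [g1y g1xy g2y] := HA (x, y) (conj A1x A2y) (qA q_gt0).
(* For [c <= 0], being within [r < |c|] of [c] would make [g2 y] negative. *)
have gc : 0 < c.
  rewrite ltNge; apply/negP => c_le0; move: yr r_lt.
  rewrite /= (ler0_norm c_le0) ltr_norml => /andP[]; lra.
have cE : `|c| = c by rewrite gtr0_norm.
have rk : r * (2 + k) = c * k by rewrite -[in RHS]cE divfK // gt_eqF // addr_gt0.
rewrite cE in r_lt.
move: xr yr; rewrite /= !ltr_norml => /andP[xr1 xr2] /andP[yr1 yr2].
have g2xy : g2 x - g2 y <= k * g2 y by nra.
(* [g2 x] is positive, so [g1 x] may be replaced by [g1 y] before comparing [g2 x] with [g2 y]. *)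
have wk : w x - w y <= k * w y.
  rewrite /= xw yw; nra.
apply: (@le_trans _ _ (k * (w y * q))).
  by rewrite mulrA ler_wpM2r // ltW.
have -> : e = k * (`|C| + 1) by rewrite divfK // gt_eqF.
apply: ler_wpM2l; first exact: ltW.
by apply: (le_trans wqC); apply: (le_trans (ler_norm _)); rewrite lerDl.
Qed.

(** Every term satisfies [w k y * q k >= - b k], so the bound [B] on the sum bounds each single term
    by [C], and the estimate for one rate applies to every [k]. *)
Lemma near_sum_increment (R : realType) (T : Type) (F : set_system T)
    (FF : Filter F) (K : finType) (w : K -> T -> R) (w0 : K -> R)
    (A : K -> T -> T -> Prop) (B e : R) :
  (forall k, w k @ F --> w0 k) ->
  (forall k, \forall x \near F, 0 <= w k x) ->
  (forall k C e', 0 < e' -> \forall x \near F & y \near F, forall q,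
    -1 <= q -> (0 < q -> A k x y) -> w k y * q <= C ->
    (w k x - w k y) * q <= e') ->
  0 < e ->
  \forall x \near F & y \near F, forall q : K -> R,
    (forall k, -1 <= q k) -> (forall k, 0 < q k -> A k x y) ->
    \sum_k w k y * q k <= B -> \sum_k (w k x - w k y) * q k <= e.
Proof.
move=> ww0 w_ge0 winc e_gt0.
pose b k := w0 k + 1.
pose C := B + \sum_k b k.
(* The [+ 1] keeps the denominator positive when [K] is empty. *)
pose e' := e / (#|K|%:R + 1).
have K1 : 0 < #|K|%:R + 1 :> R by rewrite ltr_wpDl.
have e'_gt0 : 0 < e' by rewrite divr_gt0.
have nearw : \forall y \near F, forall k, 0 <= w k y <= b k.
  apply: filter_forall => k.
  have wb : \forall y \near F, w k y < b k.
    by apply: (cvgr_lt (w0 k)); rewrite ?ltrDl //; exact: ww0.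
  by apply: filterS2 wb (w_ge0 k) => y /ltW -> ->.
have nearw2 : \forall x \near F & y \near F, forall k, 0 <= w k y <= b k.
  by exists (setT, [set y | forall k, 0 <= w k y <= b k]) => [|[x y] []];
    [split => //; exact: filterT|].
have nearA : \forall x \near F & y \near F, forall k q,
    -1 <= q -> (0 < q -> A k x y) -> w k y * q <= C ->
    (w k x - w k y) * q <= e'.
  pose P k (xy : T * T) := forall q, -1 <= q -> (0 < q -> A k xy.1 xy.2) ->
    w k xy.2 * q <= C -> (w k xy.1 - w k xy.2) * q <= e'.
  by apply: (@filter_forall _ K P (filter_prod F F)) => k; exact: winc.
apply: filterS2 nearw2 nearA => -[x y] /= wb inc q q_ge qA qB.
apply: (@le_trans _ _ (\sum_(k : K) e')); last first.
  rewrite sumr_const -mulr_natl -[leRHS](divfK (lt0r_neq0 K1)) mulrC.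
  by rewrite ler_wpM2l ?(ltW e'_gt0) // lerDl.
apply: ler_sum => k _; apply: inc => //; first exact: qA.
have wqb j : 0 <= w j y * q j + b j.
  have /andP[wj0 wjb] := wb j; have := q_ge j; nra.
apply: (@le_trans _ _ (\sum_j (w j y * q j + b j))); last first.
  by rewrite big_split /= lerD2r.
rewrite (bigD1 k) //=; apply: (@le_trans _ _ (w k y * q k + b k)).
  by have /andP[] := wb k; lra.
by rewrite lerDl sumr_ge0.
Qed.

(** The relation [r] treats both kinds of rate at once: [<=] with [b = 1] for [plus_rate], [>=] with
    [b = -1] for [minus_rate]. In both cases [~~ r] says that [x] is strictly closer to the face
    than [y]. *)
Lemma near_rate_increment (R : realType) (d : nat) (i : 'I_d) (r : rel R)
    (b : R) (w : 'rV[R]_d -> R) (z : 'rV[R]_d) (C e : R) :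
  total r -> (forall x, cube R d x -> r (x ord0 i) b) ->
  {within cube R d, continuous w} -> (forall x, cube R d x -> 0 <= w x) ->
  (forall x, cube R d x -> w x = 0) \/
  (forall x, cube R d x -> x ord0 i != b -> 0 < w x) /\
  (forall z, cube R d z -> z ord0 i = b ->
     w z = 0 /\
     exists (U : set 'rV[R]_d) (v1 : R -> R) (v2 : 'rV[R]_d -> R),
       [/\ nbhs z U,
           forall x, (U `&` cube R d) x -> w x = v1 (x ord0 i) * v2 x,
           {in [set x ord0 i | x in U `&` cube R d] &,
              forall s t, r s t -> v1 t <= v1 s},
           {within U `&` cube R d, continuous v2} &
           v2 z != 0]) ->
  cube R d z -> 0 < e ->
  \forall x \near within (cube R d) (nbhs z) & y \near within (cube R d) (nbhs z),
    forall q, -1 <= q ->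
    (0 < q -> ~~ r ((x : 'rV[R]_d) ord0 i) ((y : 'rV[R]_d) ord0 i)) ->
    w y * q <= C -> (w x - w y) * q <= e.
Proof.
move=> r_total r_b w_cont w_ge0 w_rate zE e_gt0.
have ww : w @ within (cube R d) (nbhs z) --> w z.
  by move/subspace_continuousP : w_cont; exact.
have FE : within (cube R d) (nbhs z) (cube R d) by exact: withinT.
have [wz_gt0|] := ltP 0 (w z).
  have := near_increment_pos _ C wz_gt0 ww e_gt0.
  by move=> [S FS SP]; exists S => // xy Sxy q q_ge _; exact: SP.
move=> wz_le0; have wz0 : w z = 0 by apply/eqP; rewrite eq_le wz_le0 w_ge0.
rewrite wz0 in ww.
case: w_rate => [w0|[w_gt0 /(_ z zE)]].
  exists (cube R d, cube R d) => //= -[x y] [/= xE yE] q _ _ _.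
  by rewrite !w0 // subrr mul0r ltW.
have zb : z ord0 i = b.
  by apply/eqP; apply: contraTT wz_le0 => zb; rewrite -ltNge w_gt0.
move=> /(_ zb) [_ [U [v1 [v2 [zU w_eq v1_mono v2_cont v2z]]]]].
have Uz : U z := nbhs_singleton zU.
have FU : within (cube R d) (nbhs z) (U `&` cube R d).
  by apply: filterS zU => x Ux xE; split.
(* As [U] is a neighbourhood of [z], limits within [U] and the cube are limits within the cube. *)
have v2v2 : v2 @ within (cube R d) (nbhs z) --> v2 z.
  move/subspace_continuousP : v2_cont => /(_ z (conj Uz zE)) v2v2.
  apply: cvg_trans v2v2; apply: cvg_app => S /= zS.
  by apply: filterS2 zU zS => x Ux + xE; apply.
have v1_in x : (U `&` cube R d) x ->
    x ord0 i \in [set x ord0 i | x in U `&` cube R d].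
  by move=> Ux; rewrite inE; exists x.
apply: (@near_increment_factor R _ _ _ w (fun x => v1 (x ord0 i)) v2 _ C e
  (fun x y => ~~ r (x ord0 i) (y ord0 i)) v2z v2v2 ww) => //.
  exact: filterS FU.
exists (U `&` cube R d, U `&` cube R d) => //= -[x y] [/= Ux Uy] rxy.
have ryx : r (y ord0 i) (x ord0 i).
  by have := r_total (x ord0 i) (y ord0 i); rewrite (negPf rxy).
(* The point [y] is off the face, since no point of the cube lies strictly beyond it; hence
   [w y > 0]. *)
have yb : y ord0 i != b.
  by apply: contraNneq rxy => ->; apply: r_b; case: Ux.
(* This fixes the signs: monotonicity gives [v1 >= 0] at [y], and [w y > 0] then forces
   [v2 y >= 0]. *)
have v1z : v1 b = 0.
  by apply/eqP; move: wz0; rewrite w_eq // zb => /eqP; rewrite mulf_eq0 (negPf v2z) orbF.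
have v1y : 0 <= v1 (y ord0 i).
  rewrite -v1z; apply: v1_mono; [exact: v1_in| |by apply: r_b; case: Uy].
  by rewrite -zb; exact: v1_in.
split=> //; first by apply: v1_mono => //; exact: v1_in.
have := w_gt0 _ (proj2 Uy) yb; rewrite w_eq // => v12.
by rewrite leNgt; apply/negP => v2_lt0; move: v12; rewrite ltNge mulr_ge0_le0 // ltW.
Qed.

(** * Penalised maximisation over the cube *)

Lemma cube_compact (R : realType) (d : nat) : compact (cube R d).
Proof.
have := @rV_compact R d (fun=> `[-1, 1]%classic) (fun=> @segment_compact _ _ _).
by congr compact; apply/seteqP; split=> x /= xE i; have := xE i; rewrite in_itv.
Qed.

Lemma sqdist_ge0 (R : realType) (d : nat) (x y : 'rV[R]_d) : 0 <= sqdist x y.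
Proof. by apply: sumr_ge0 => i _; exact: sqr_ge0. Qed.

Lemma sqdistxx (R : realType) (d : nat) (x : 'rV[R]_d) : sqdist x x = 0.
Proof. by rewrite /sqdist big1 // => i _; rewrite subrr expr0n. Qed.

Lemma sqdistC (R : realType) (d : nat) (x y : 'rV[R]_d) : sqdist x y = sqdist y x.
Proof. by apply: eq_bigr => i _; rewrite -sqrrN opprB. Qed.

Lemma ball_sqdist (R : realType) (d : nat) (x y : 'rV[R]_d) (e : R) :
  0 < e -> sqdist x y < e ^+ 2 -> ball x e y.
Proof.
move=> e_gt0 xye; split => // i j; rewrite ord1 /ball /=.
rewrite -ltr_sqr ?nnegrE ?(ltW e_gt0) // real_normK ?num_real //.
apply: le_lt_trans xye; rewrite /sqdist (bigD1 j) //= lerDl.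
by apply: sumr_ge0 => k _; exact: sqr_ge0.
Qed.

Lemma continuous_sqdist (R : realType) (d : nat) :
  continuous (fun xy : 'rV[R]_d * 'rV[R]_d => sqdist xy.1 xy.2).
Proof.
move=> [x y]; rewrite /sqdist.
apply: cvg_big => [|i _]; first exact: add_continuous.
have c1 : (fun xy : 'rV[R]_d * 'rV[R]_d => xy.1 ord0 i) @ (x, y) --> x ord0 i.
  apply: (@cvg_comp _ _ _ fst (fun t : 'rV[R]_d => t ord0 i) _ (nbhs x)).
    exact: cvg_fst.
  exact: coord_continuous.
have c2 : (fun xy : 'rV[R]_d * 'rV[R]_d => xy.2 ord0 i) @ (x, y) --> y ord0 i.
  apply: (@cvg_comp _ _ _ snd (fun t : 'rV[R]_d => t ord0 i) _ (nbhs y)).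
    exact: cvg_snd.
  exact: coord_continuous.
have c12 := cvgB c1 c2 (FF := nbhs_filter (x, y)).
have := cvgM c12 c12 (FF := nbhs_filter (x, y)).
exact.
Qed.

(** Indexes all [2 * d] jump terms by one finite type, as [near_sum_increment] requires; [true]
    marks the upward jumps. *)
Lemma ehrenfest_hamiltonianE (R : realType) (d : nat)
    (vp vm : 'I_d -> 'rV[R]_d -> R) (x p : 'rV[R]_d) :
  ehrenfest_hamiltonian vp vm x p =
  \sum_(k : 'I_d * bool) (if k.2 then vp k.1 else vm k.1) x *
    (expR ((if k.2 then 2 else - 2) * p ord0 k.1) - 1).
Proof.
rewrite -(pair_bigA _ (fun i b => (if b then vp i else vm i) x *
   (expR ((if b then 2 else - 2) * p ord0 i) - 1))) /=.
by apply: eq_bigr => i _; rewrite big_bool.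
Qed.

Lemma penalized_max (R : realType) (d : nat) (E : set 'rV[R]_d)
    (u v : 'rV[R]_d -> R) (c : R) :
  compact E -> E !=set0 -> usc_on E u -> lsc_on E v ->
  exists x y, [/\ E x, E y & forall x' y', E x' -> E y' ->
    u x' - v y' - c * sqdist x' y' <= u x - v y - c * sqdist x y].
Proof.
move=> cE [x0 Ex0] uscu lscv.
have [|||[x y] /= [Ex Ey] xy_max] := @usc_compact_max R _ (E `*` E)
    (fun xy => u xy.1 - v xy.2 - c * sqdist xy.1 xy.2).
- exact: compact_setX.
- by exists (x0, x0).
- move=> [x y] [/= Ex Ey] a; set Phi := u x - v y - _ => Pa.
  (* The gap [a - Phi] is shared equally among [u], [v] and the penalty. *)
  have e_gt0 : 0 < (a - Phi) / 3 by lra.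
  have /= nearu : \forall t \near within E (nbhs x), - u x - (a - Phi) / 3 < - u t.
    by apply: (lsc_on_near uscu) => //; lra.
  have /= nearv : \forall t \near within E (nbhs y), v y - (a - Phi) / 3 < v t.
    by apply: (lsc_on_near lscv) => //; lra.
  have cq : (fun st : 'rV[R]_d * 'rV[R]_d => c * sqdist st.1 st.2) @ (x, y)
      --> c * sqdist x y.
    by apply: cvgM; [exact: cvg_cst|exact: (@continuous_sqdist R d (x, y))].
  have nearq : \forall st \near nbhs (x, y),
      c * sqdist x y - (a - Phi) / 3 < c * sqdist st.1 st.2.
    by apply: (cvgr_gt _ cq); lra.
  have nearuv : nbhs (x, y) [set st | (E st.1 -> - u x - (a - Phi) / 3 < - u st.1) /\
      (E st.2 -> v y - (a - Phi) / 3 < v st.2)].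
    by exists ([set t | E t -> - u x - (a - Phi) / 3 < - u t],
      [set t | E t -> v y - (a - Phi) / 3 < v t]).
  apply: filterS2 nearq nearuv => -[s t] /= qst [us vt] [/us us' /vt vt'].
  rewrite /Phi in qst us' vt' *; lra.
- by exists x, y; split=> // x' y' Ex' Ey'; apply: (xy_max (x', y')).
Qed.

(** * Comparison by doubling of variables *)

Theorem theorem2p6 (R : realType) (d : nat) (hd : (1 <= d)%N)
    (vp vm : 'I_d -> 'rV[R]_d -> R)
    (vp_cont : forall i, {within cube R d, continuous (vp i)})
    (vm_cont : forall i, {within cube R d, continuous (vm i)})
    (vp_ge0 : forall i x, cube R d x -> 0 <= vp i x)
    (vm_ge0 : forall i x, cube R d x -> 0 <= vm i x)
    (vp_rate : forall i, plus_rate i (vp i))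
    (vm_rate : forall i, minus_rate i (vm i))
    (lambda : R) (lambda_gt0 : 0 < lambda)
    (h : 'rV[R]_d -> R) (h_cont : {within cube R d, continuous h}) :
  comparison_principle (cube R d) (ehrenfest_hamiltonian vp vm) lambda h.
Proof.
move=> u v [u_bdd u_usc u_sub] [v_bdd v_lsc v_super] x0 x0E.
have [Mu _ /= uM] := pinfty_ex_gt0 u_bdd.
have [Mv _ /= vM] := pinfty_ex_gt0 v_bdd.
set E := cube R d in u_usc v_lsc x0E uM vM *.
have EN0 : E !=set0 by exists x0.
pose is_max (n : nat) (xy : 'rV[R]_d * 'rV[R]_d) :=
  [/\ E xy.1, E xy.2 & forall x' y', E x' -> E y' ->
  u x' - v y' - n%:R * sqdist x' y' <=
    u xy.1 - v xy.2 - n%:R * sqdist xy.1 xy.2].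
have [xys xysP] : {xys & forall n, is_max n (xys n)}.
  apply: choice => n.
  have [x [y xyP]] := penalized_max n%:R (@cube_compact R d) EN0 u_usc v_lsc.
  by exists (x, y).
pose xs n := (xys n).1; pose ys n := (xys n).2.
have xsE n : E (xs n) by case: (xysP n).
have ysE n : E (ys n) by case: (xysP n).
(* Freezing one variable of the maximising pair gives a test function in the other. *)
have xs_max n x : E x -> u x - n%:R * sqdist x (ys n) <=
    u (xs n) - n%:R * sqdist (xs n) (ys n).
  move=> Ex; case: (xysP n) => _ yE /(_ x (ys n) Ex yE).
  by rewrite -/(xs n) -/(ys n); lra.
have ys_max n y : E y -> v (ys n) - (- n%:R) * sqdist (ys n) (xs n) <=
    v y - (- n%:R) * sqdist y (xs n).
  move=> Ey; rewrite !(sqdistC _ (xs n)).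
  by case: (xysP n) => xE _ /(_ (xs n) y xE Ey); rewrite -/(xs n) -/(ys n); lra.
have xys_max n : u x0 - v x0 <= u (xs n) - v (ys n) - n%:R * sqdist (xs n) (ys n).
  by case: (xysP n) => _ _ /(_ x0 x0 x0E x0E); rewrite sqdistxx mulr0 subr0.
(* Comparison with the diagonal pair [(x0, x0)] bounds [n * sqdist] by [Mu + Mv - (u x0 - v x0)]. *)
have xys_close e : 0 < e -> \forall n \near \oo, ball (xs n) e (ys n).
  move=> e_gt0; have e2_gt0 : 0 < e ^+ 2 by rewrite exprn_gt0.
  have := @nbhs_infty_gtr R ((Mu + Mv - (u x0 - v x0)) / e ^+ 2).
  apply: filterS => n; rewrite ltr_pdivrMr // => n_big.
  apply: ball_sqdist => //; rewrite ltNge; apply/negP => e_le.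
  have := xys_max n.
  have : n%:R * e ^+ 2 <= n%:R * sqdist (xs n) (ys n) by rewrite ler_wpM2l.
  have := le_trans (ler_norm _) (uM _ (xsE n)).
  have := vM _ (ysE n); rewrite ler_norml => /andP[].
  lra.
have [z zE zP] := compact_cluster_pair (@cube_compact R d) xsE ysE xys_close.
rewrite leNgt; apply/negP => vu_lt.
(* [(lambda + 1) * e] is half the supposed gap: [lambda * e] will pay for the Hamiltonians and [e]
   for [h]. *)
pose e := (u x0 - v x0) / (lambda + 1) / 2.
have l1_gt0 : 0 < lambda + 1 by rewrite addr_gt0.
have e_gt0 : 0 < e by rewrite !divr_gt0 // subr_gt0.
pose w (k : 'I_d * bool) := if k.2 then vp k.1 else vm k.1.
pose r (k : 'I_d * bool) : rel R :=
  if k.2 then (fun s t => s <= t) else (fun s t => t <= s).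
(* Upper bound for [H] at [ys n] given by the supersolution inequality, with [h] within 1 of
   [h z]. *)
pose B := (Mv - h z + 1) / lambda.
have hh : h @ within E (nbhs z) --> h z.
  by move/subspace_continuousP : h_cont; exact.
have w_cont k : {within E, continuous (w k)} by rewrite /w; case: k.2.
have w_ge0 k x : E x -> 0 <= w k x.
  by rewrite /w; case: k.2; [exact: vp_ge0|exact: vm_ge0].
have w_inc k C e' : 0 < e' ->
    \forall x \near within E (nbhs z) & y \near within E (nbhs z), forall q,
    -1 <= q -> (0 < q -> ~~ r k ((x : 'rV[R]_d) ord0 k.1) ((y : 'rV[R]_d) ord0 k.1)) ->
    w k y * q <= C -> (w k x - w k y) * q <= e'.
  move=> e'_gt0; apply: (near_rate_increment (b := if k.2 then 1 else -1)) => //.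
  - by rewrite /r; case: k.2 => s t; rewrite le_total.
  - by rewrite /r => x /(_ k.1) /andP[]; case: k.2.
  - exact: w_ge0.
  rewrite /w /r; case: k => i [] /=.
    exact: vp_rate.
  (* For downward jumps [r] is the reversed order, in which nondecreasing factors become
     nonincreasing. *)
  case: (vm_rate i) => [|[vm_gt0 vm_fac]]; [by left|right; split => // t tE ti].
  have [-> [U [v1 [v2 [zU fac v1_mono v2_cont v2_neq0]]]]] := vm_fac t tE ti.
  by split=> //; exists U, v1, v2; split=> // s1 s2 s1P s2P; exact: v1_mono.
have nearw : \forall x \near within E (nbhs z) & y \near within E (nbhs z),
    forall q : 'I_d * bool -> R, (forall k, -1 <= q k) ->
    (forall k, 0 < q k -> ~~ r k ((x : 'rV[R]_d) ord0 k.1) ((y : 'rV[R]_d) ord0 k.1)) ->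
    \sum_k w k y * q k <= B -> \sum_k (w k x - w k y) * q k <= e.
  apply: (@near_sum_increment R _ _ _ _ w (fun k => w k z)
    (fun k x y => ~~ r k (x ord0 k.1) (y ord0 k.1))) => //.
  - by move=> k; move/subspace_continuousP : (w_cont k); exact.
  - by move=> k; apply: (filterS (w_ge0 k)); exact: withinT.
have nearh : \forall y \near within E (nbhs z), `|h z - h y| < Num.min 1 (e / 2).
  by move/cvgrPdist_lt : hh; apply; rewrite lt_min ltr01 divr_gt0.
have [|n [nw nhx nhy]] := zP (fun x y =>
    [/\ forall q : 'I_d * bool -> R, (forall k, -1 <= q k) ->
    (forall k, 0 < q k -> ~~ r k (x ord0 k.1) (y ord0 k.1)) ->
    \sum_k w k y * q k <= B -> \sum_k (w k x - w k y) * q k <= e,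
    `|h z - h x| < Num.min 1 (e / 2) & `|h z - h y| < Num.min 1 (e / 2)]).
  have [[S1 S2] /= [FS1 FS2] S12] := nearw.
  exists (S1 `&` [set y | `|h z - h y| < Num.min 1 (e / 2)],
          S2 `&` [set y | `|h z - h y| < Num.min 1 (e / 2)]).
    by split; exact: filterI.
  by move=> [x y] [/= [S1x hx] [S2y hy]]; split=> //; exact: (S12 (x, y)).
move: nhx nhy; rewrite !lt_min !ltr_norml.
move=> /andP[/andP[hx1 hx2] /andP[hx3 hx4]] /andP[/andP[hy1 hy2] /andP[hy3 hy4]].
have := u_sub _ _ (C1_sqdist E n%:R (ys n)) (xsE n) (xs_max n).
have := v_super _ _ (C1_sqdist E (- n%:R) (xs n)) (ysE n) (ys_max n).
rewrite !grad_sqdist.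
(* Both test functions have the same gradient, so the two Hamiltonians share the factors [q]. *)
have -> : (2 * - n%:R) *: (ys n - xs n) = (2 * n%:R) *: (xs n - ys n).
  by rewrite -[in RHS]opprB scalerN mulrN scaleNr.
rewrite !ehrenfest_hamiltonianE.
set q := fun k : 'I_d * bool => expR ((if k.2 then 2 else -2) *
  ((2 * n%:R) *: (xs n - ys n)) ord0 k.1) - 1.
rewrite -/w -/q.
set Hx := \sum_k w k (xs n) * q k; set Hy := \sum_k w k (ys n) * q k.
move=> Hy_le Hx_ge.
have vyM : v (ys n) <= Mv by exact: le_trans (ler_norm _) (vM _ (ysE n)).
have HyB : Hy <= B.
  by rewrite /B ler_pdivlMr // mulrC; lra.
have q_ge k : -1 <= q k by rewrite lerBrDr addrC subrr expR_ge0.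
(* A positive [q k] means a positive exponent, hence [xs n] strictly ahead of [ys n] in the
   direction of the jump. *)
have q_gt k : 0 < q k -> ~~ r k (xs n ord0 k.1) (ys n ord0 k.1).
  rewrite subr_gt0 -[ltLHS]expR0 ltr_expR !mxE /r.
  have n_ge0 : 0 <= n%:R :> R by [].
  by case: k.2 => qk; apply/negP => xy_le; nra.
have Hxy := nw q q_ge q_gt HyB.
have HxyE : \sum_k (w k (xs n) - w k (ys n)) * q k = Hx - Hy.
  by rewrite -sumrB; apply: eq_bigr => k _; rewrite mulrBl.
rewrite HxyE in Hxy.
have lHxy : lambda * (Hx - Hy) <= lambda * e by rewrite ler_wpM2l // ltW.
have D_le : u x0 - v x0 <= u (xs n) - v (ys n).
  have := xys_max n.
  by have := mulr_ge0 (ler0n R n) (sqdist_ge0 (xs n) (ys n)); lra.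
have eE : u x0 - v x0 = (lambda + 1) * e * 2.
  by rewrite /e; field; rewrite gt_eqF.
(* Subtracting the two viscosity inequalities bounds the gap by [(lambda + 1) * e], which is half of
   it. *)
have := mulr_gt0 l1_gt0 e_gt0; lra.
Qed.
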